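(* Let $(a,c)\in\mathbb{R}^2$ be such that $T$ has a 3-cycle with symbolic sequence $4\to 3\to 4$, i.e. three distinct points $p_1\in Q_4$, $p_2\in Q_3$, $p_3\in Q_4$ with $p_2=T_4(p_1)$, $p_3=T_3(p_2)$, $p_1=T_4(p_3)$. Then this 3-cycle is stable if and only if $(a,c)$ satisfies the following three conditions: (1) $|(a-c)(a+c)^2|<1$; (2) $-a^3-a^2c+(c^2+3c-1)a+2c^3+2>0$; (3) $a^2+ac-c^2+3c-1>0$.
   Context: For real parameters $a,c$, $T:\mathbb{R}^2\to\mathbb{R}^2$ is $T(x,y)=(|x|+ay-1,\;x+c|y|-1)$. The closed quadrants are $Q_1=\{x\ge 0,y\ge 0\}$, $Q_2=\{x\le 0,y\ge 0\}$, $Q_3=\{x\le 0,y\le 0\}$, $Q_4=\{x\ge 0,y\le 0\}$. On $Q_3$ the map $T$ coincides with $T_3(x,y)=(-x+ay-1,x-cy-1)$, with linear part $J_3=\begin{pmatrix}-1&a\\1&-c\end{pmatrix}$, and on $Q_4$ with $T_4(x,y)=(x+ay-1,x-cy-1)$, with linear part $J_4=\begin{pmatrix}1&a\\1&-c\end{pmatrix}$. The 3-cycle is called stable if all eigenvalues $\lambda\in\mathbb{C}$ of the Jacobian product $J_4J_3J_4$ along the cycle satisfy $|\lambda|<1$. *)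

(* Defs.v *)
From HB Require Import structures.
From mathcomp Require Import all_boot all_order all_algebra.
From mathcomp Require Import reals complex.

Set Implicit Arguments.
Unset Strict Implicit.
Unset Printing Implicit Defensive.

Import Order.TTheory GRing.Theory Num.Theory.
Local Open Scope ring_scope.
Local Open Scope complex_scope.

Definition T (R : realType) (a c : R) (p : R * R) : R * R :=
  (`|p.1| + a * p.2 - 1, p.1 + c * `|p.2| - 1).

Definition Q3 (R : realType) (p : R * R) : bool := (p.1 <= 0) && (p.2 <= 0).
Definition Q4 (R : realType) (p : R * R) : bool := (0 <= p.1) && (p.2 <= 0).

Definition T3 (R : realType) (a c : R) (p : R * R) : R * R :=
  (- p.1 + a * p.2 - 1, p.1 - c * p.2 - 1).

Definition T4 (R : realType) (a c : R) (p : R * R) : R * R :=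
  (p.1 + a * p.2 - 1, p.1 - c * p.2 - 1).

Definition mx22 (R : realType) (m00 m01 m10 m11 : R) : 'M[R]_2 :=
  \matrix_(i, j) (if i == 0 then if j == 0 then m00 else m01
                  else if j == 0 then m10 else m11).

Definition J3 (R : realType) (a c : R) : 'M[R]_2 := mx22 (- 1) a 1 (- c).
Definition J4 (R : realType) (a c : R) : 'M[R]_2 := mx22 1 a 1 (- c).

Definition cycle434 (R : realType) (a c : R) (p1 p2 p3 : R * R) : Prop :=
  [/\ [/\ p1 != p2, p2 != p3 & p1 != p3],
      [/\ Q4 p1, Q3 p2 & Q4 p3] &
      [/\ p2 = T4 a c p1, p3 = T3 a c p2 & p1 = T4 a c p3]].

(* The Jacobian is constant on each quadrant, so the product along a cycle
   4 -> 3 -> 4 does not depend on the points. Eigenvalues are taken over the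
   complex numbers R[i]; `|l| is the complex modulus, as an element of R[i]. *)
Definition stable434 (R : realType) (a c : R) : Prop :=
  forall l : R[i],
    eigenvalue (map_mx (real_complex R) (J4 a c *m J3 a c *m J4 a c)) l ->
    `|l| < 1.

Lemma T_Q3 (R : realType) (a c : R) (p : R * R) : Q3 p -> T a c p = T3 a c p.
Proof.
by case/andP=> h1 h2; rewrite /T /T3 !ler0_norm // mulrN.
Qed.

Lemma T_Q4 (R : realType) (a c : R) (p : R * R) : Q4 p -> T a c p = T4 a c p.
Proof.
by case/andP=> h1 h2; rewrite /T /T4 ger0_norm // ler0_norm // mulrN.
Qed.

Lemma cycle434_T (R : realType) (a c : R) (p1 p2 p3 : R * R) :
  cycle434 a c p1 p2 p3 <->
  [/\ [/\ p1 != p2, p2 != p3 & p1 != p3],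
      [/\ Q4 p1, Q3 p2 & Q4 p3] &
      [/\ p2 = T a c p1, p3 = T a c p2 & p1 = T a c p3]].
Proof.
split=> -[d [q1 q2 q3] e]; split=> //.
  by rewrite !(T_Q4 a c q1, T_Q3 a c q2, T_Q4 a c q3).
by rewrite -(T_Q4 a c q1) -(T_Q3 a c q2) -(T_Q4 a c q3).
Qed.

Definition cv_of_pt (R : realType) (p : R * R) : 'cV[R]_2 :=
  \col_i (if i == 0 then p.1 else p.2).

Lemma T3_affine (R : realType) (a c : R) (p : R * R) :
  cv_of_pt (T3 a c p) = J3 a c *m cv_of_pt p - const_mx 1.
Proof.
apply/matrixP=> i j; rewrite !mxE !big_ord_recl big_ord0 !mxE /=.
by case: eqP => _; rewrite addr0 ?mulN1r ?mul1r ?mulNr.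
Qed.

Lemma T4_affine (R : realType) (a c : R) (p : R * R) :
  cv_of_pt (T4 a c p) = J4 a c *m cv_of_pt p - const_mx 1.
Proof.
apply/matrixP=> i j; rewrite !mxE !big_ord_recl big_ord0 !mxE /=.
by case: eqP => _; rewrite addr0 ?mulN1r ?mul1r ?mulNr.
Qed.

(* Main.v *)
Require Import Defs.
From HB Require Import structures.
From mathcomp Require Import all_boot all_order all_algebra.
From mathcomp Require Import reals complex.
From mathcomp Require Import ring lra.

(** The product M = J4 J3 J4 is a real 2 x 2 matrix, so its eigenvalues are the
    complex roots of X^2 - t X + d with t = tr M and d = det M.  Both roots lie
    in the open unit disc exactly when the Schur-Cohn (Jury) inequalities
    |d| < 1, 0 < 1 - t + d and 0 < 1 + t + d hold ([schur_cohn2]).  Here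
    d = - (a - c) (a + c)^2, so |d| is the absolute value to be bounded;
    1 - t + d is the cubic to be positive; and 1 + t + d factors as
    - a (a^2 + a c - c^2 + 3 c - 1), the quadratic to be positive multiplied
    by - a.  The equivalence therefore comes down to a < 0, which the
    characteristic polynomial cannot provide: for a = 0 and c = 1/2 the three
    conditions hold although -1 is an eigenvalue.  It is the existence of the
    cycle, through the signs of the coordinates of its points, that excludes
    a >= 0 ([cycle434_a_lt0]). *)

Set Implicit Arguments.
Unset Strict Implicit.
Unset Printing Implicit Defensive.

Import Order.TTheory GRing.Theory Num.Theory.
Local Open Scope ring_scope.

Lemma det_mx2 (K : comPzRingType) (A : 'M[K]_2) :
  \det A = A 0 0 * A 1 1 - A 0 1 * A 1 0.
Proof.
rewrite (expand_det_row _ 0) !big_ord_recl big_ord0 /cofactor !det_mx11 !mxE.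
rewrite addr0 expr0 mul1r expr1 mulN1r mulrN.
by congr (_ * A _ _ - A _ _ * A _ _); apply/val_inj.
Qed.

Lemma mxtrace2 (K : pzSemiRingType) (A : 'M[K]_2) : \tr A = A 0 0 + A 1 1.
Proof.
rewrite /mxtrace !big_ord_recl big_ord0 addr0.
by congr (_ + A _ _); apply/val_inj.
Qed.

Lemma eigenvalue_mx2 (F : fieldType) (A : 'M[F]_2) (l : F) :
  eigenvalue A l = (l ^+ 2 - \tr A * l + \det A == 0).
Proof.
rewrite eigenvalue_root_char rootE /char_poly det_mx2 !mxE /= !hornerE.
by rewrite mxtrace2 det_mx2; congr (_ == 0); ring.
Qed.

Lemma ltc_norm1 (R : rcfType) (x y : R) :
  (`|(x +i* y)%C| < 1) = (x ^+ 2 + y ^+ 2 < 1).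
Proof.
rewrite normc_def /= -[1]/(1%:C)%C ltcR -[X in _ < X]sqrtr1.
by rewrite ltr_sqrt // ltr01.
Qed.

(** The imaginary part is kept factored: either the root is real, or its real
    part is half the sum of the two conjugate roots. *)
Lemma quadratic_complexE (R : rcfType) (t d x y : R) :
  let l := (x +i* y)%C in
  (l ^+ 2 - (t%:C)%C * l + (d%:C)%C = 0) <->
  x ^+ 2 - y ^+ 2 - t * x + d = 0 /\ y * (2 * x - t) = 0.
Proof.
move=> l.
have -> : l ^+ 2 - (t%:C)%C * l + (d%:C)%C =
          ((x ^+ 2 - y ^+ 2 - t * x + d) +i* (y * (2 * x - t)))%C.
  by rewrite /l expr2; simpc; congr (_ +i* _)%C; ring.
by split=> [[-> ->]|[-> ->]].
Qed.

(** When the roots are real, they lie in ]-1, 1[ iff the quadratic is positive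
    at 1 and -1 and its vertex t/2 lies in ]-1, 1[; the vertex condition
    follows from |t| < 1 + d < 2.
    When they are conjugate, their common squared modulus is d, and
    t^2 < 4 d <= (1 + d)^2 gives positivity at 1 and -1. *)
Lemma schur_cohn2 (R : rcfType) (t d : R) :
  (forall l : R[i], l ^+ 2 - (t%:C)%C * l + (d%:C)%C = 0 -> `|l| < 1) <->
  [/\ `|d| < 1, 0 < 1 - t + d & 0 < 1 + t + d].
Proof.
split=> [stable|[/ltr_normlP[d_gtN1 d_lt1] p1_gt0 pN1_gt0] [x y]].
  (* Stability in real coordinates, to be tested on the explicit roots. *)
  have root_lt1 x y : x ^+ 2 - y ^+ 2 - t * x + d = 0 -> y * (2 * x - t) = 0 ->
      x ^+ 2 + y ^+ 2 < 1.
    by move=> re0 im0; rewrite -ltc_norm1; apply/stable/quadratic_complexE.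
  have [disc_ge0|disc_lt0] := leP 0 (t ^+ 2 - 4 * d).
    set s := Num.sqrt (t ^+ 2 - 4 * d).
    have s2 : s ^+ 2 = t ^+ 2 - 4 * d by rewrite sqr_sqrtr.
    have s_ge0 : 0 <= s by rewrite sqrtr_ge0.
    have r1 : ((t + s) / 2) ^+ 2 + 0 ^+ 2 < 1 by apply: root_lt1; lra.
    have r2 : ((t - s) / 2) ^+ 2 + 0 ^+ 2 < 1 by apply: root_lt1; lra.
    have h1 : t + s < 2 by nra.
    have h2 : - 2 < t - s by nra.
    split; [apply/ltr_normlP; split|..]; nra.
  set s := Num.sqrt (4 * d - t ^+ 2).
  have s2 : s ^+ 2 = 4 * d - t ^+ 2 by rewrite sqr_sqrtr //; lra.
  have r : (t / 2) ^+ 2 + (s / 2) ^+ 2 < 1 by apply: root_lt1; lra.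
  split; [apply/ltr_normlP; split|..]; nra.
move/quadratic_complexE=> [re0 /eqP]; rewrite ltc_norm1 mulf_eq0.
(* For a nonreal root, t = 2 x turns the real part into x^2 + y^2 = d. *)
case/orP=> /eqP im0; last by nra.
(* The root is real from here on; beyond 1 or below -1 the quadratic is
   monotone, hence positive. *)
have x_lt1 : x < 1 by rewrite ltNge; apply/negP=> x_ge1; nra.
have x_gtN1 : - 1 < x by rewrite ltNge; apply/negP=> x_leN1; nra.
nra.
Qed.

(** Suppose a >= 0 and put m = - (a + c).  Going once around the cycle
    gives 2 x1 + 1 = a (y2 + y3 - y1), so x1 >= 0 bounds the right-hand side
    below by 1; since y2, y3 <= 0, this makes y1 strictly smaller than both y2
    and y3.  Eliminating x3 with x1 >= 0, then x1 with x2 <= 0, gives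
    m y3 <= y1 and y2 <= m y1.  As the y's are nonpositive, the first
    forces m > 1 and the second forces m < 1. *)
Lemma cycle434_a_lt0 (R : realType) (a c : R) (p1 p2 p3 : R * R) :
  cycle434 a c p1 p2 p3 -> a < 0.
Proof.
case: p1 p2 p3 => [x1 y1] [x2 y2] [x3 y3] [_ [/andP[/= x1_ge0 y1_le0]]].
move=> /andP[/= x2_le0 y2_le0] /andP[/= x3_ge0 y3_le0].
case=> -[/= x2E y2E] [/= x3E y3E] [/= x1E y1E].
rewrite ltNge; apply/negP=> a_ge0.
have cycle_sum : 2 * x1 + 1 = a * (y2 + y3 - y1) by lra.
have y31 : y1 < y3 by nra.
have y21 : y1 < y2 by nra.
have y1_ge : - (a + c) * y3 <= y1 by lra.
have y2_le : y2 <= - (a + c) * y1 by lra.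
have [m_le1|m_gt1] := leP (- (a + c)) 1; nra.
Qed.

Theorem proposition3p12 (R : realType) (a c : R) (p1 p2 p3 : R * R)
    (hcycle : cycle434 a c p1 p2 p3) :
  stable434 a c <->
  [/\ `|(a - c) * (a + c) ^+ 2| < 1,
      0 < - a ^+ 3 - a ^+ 2 * c + (c ^+ 2 + 3 * c - 1) * a + 2 * c ^+ 3 + 2 &
      0 < a ^+ 2 + a * c - c ^+ 2 + 3 * c - 1].
Proof.
have a_lt0 := cycle434_a_lt0 hcycle.
set M := J4 a c *m J3 a c *m J4 a c.
have trM : \tr M = a - 1 - 3 * a * c - c ^+ 3.
  rewrite mxtrace2 /M !mxE.
  by rewrite !big_ord_recl !big_ord0 !mxE !big_ord_recl !big_ord0 !mxE /=; ring.
have detM : \det M = - ((a - c) * (a + c) ^+ 2).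
  by rewrite /M !det_mulmx !det_mx2 !mxE /=; ring.
have stableE : stable434 a c <-> forall l : R[i],
    l ^+ 2 - ((\tr M)%:C)%C * l + ((\det M)%:C)%C = 0 -> `|l| < 1.
  split=> stable l.
    move=> l0; apply: stable; rewrite eigenvalue_mx2 trace_map_mx det_map_mx.
    exact/eqP.
  rewrite eigenvalue_mx2 trace_map_mx det_map_mx => /eqP; exact: stable.
have pN1E : 1 + \tr M + \det M = - a * (a ^+ 2 + a * c - c ^+ 2 + 3 * c - 1).
  by rewrite trM detM; ring.
have p1E : 1 - \tr M + \det M =
    - a ^+ 3 - a ^+ 2 * c + (c ^+ 2 + 3 * c - 1) * a + 2 * c ^+ 3 + 2.
  by rewrite trM detM; ring.
apply: (iff_trans stableE); apply: (iff_trans (schur_cohn2 _ _)).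
by rewrite pN1E p1E detM normrN pmulr_rgt0 // oppr_gt0.
Qed.
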